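(* Let $d\in\mathbb{N}$, let $\Omega\subset\mathbb{R}^d$ be a bounded domain with smooth boundary $\Gamma$, let $H>0$, let $w\in\mathcal{W}$ be a reference weight function, and let $(\mathcal{X}_N,\mathcal{V}_N,h)$ be discrete parameters (particle distribution, particle volume set, influence radius) as defined in the context. Suppose that the particle distribution $\mathcal{X}_N$ satisfies $h$-connectivity. Then for every given $f\in(V\cap C^1(\overline{\Omega}))^d$, with $\widehat{f}\in V_h^d$ given by $\widehat{f}_i=f(x_i)$ for $i\in\Lambda(\Omega)$ and $\widehat{f}_i=0$ for $i\in\Lambda(\Gamma_H)$, the discrete Poisson equation $$\text{Find } \mathrm{u}\in V_h \text{ such that } -\Delta_h \mathrm{u}_i=\nabla_h^{+}\cdot\widehat{f}_i\quad\text{for all } i\in\Lambda(\Omega)$$ has a unique solution.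
   Context: $C(\overline{\Omega})$ is the space of real continuous functions on $\overline{\Omega}$, $C^k(\overline{\Omega})$ is the space of functions in $C(\overline{\Omega})$ with derivatives up to order $k$ (in $C(\overline\Omega)$), and $V=\{v\in C(\overline{\Omega}) : v(x)=0 \text{ for } x\in\Gamma\}$. For fixed $H>0$: $\Omega_H=\{x\in\mathbb{R}^d : \exists y\in\Omega,\ |x-y|<H\}$ and $\Gamma_H=\Omega_H\setminus\Omega$; $|\Omega_H|$ is the volume of $\Omega_H$. For $N\in\mathbb{N}$, a particle distribution is a set $\mathcal{X}_N=\{x_i\in\Omega_H : i=1,\dots,N,\ x_i\ne x_j\ (i\ne j)\}$, and a particle volume set is $\mathcal{V}_N=\{\omega_i>0 : i=1,\dots,N,\ \sum_{i=1}^N\omega_i=|\Omega_H|\}$. The influence radius $h$ is a positive number with $\min\{|x_i-x_j| : i\neq j\}<h<H$. Reference weight functions: $\mathcal{W}$ is the set of $w:[0,\infty)\to\mathbb{R}$ with $w(r)>0$ for $0<r<1$, $w(r)=0$ for $r\ge 1$, and $\int_{\mathbb{R}^d}w(|x|)\,dx=1$. The weight function is $w_h(r)=h^{-d}w(r/h)$. For a function $\phi$ on $\mathcal{X}_N$ write $\phi_i=\phi(x_i)$. For $\psi:\mathcal{X}_N\to\mathbb{R}^d$ and $\phi:\mathcal{X}_N\to\mathbb{R}$, $$\nabla_h^{+}\cdot\psi_i=d\sum_{j\ne i}\omega_j\frac{\psi_j+\psi_i}{|x_j-x_i|}\cdot\frac{x_j-x_i}{|x_j-x_i|}\,w_h(|x_j-x_i|),$$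 $$\Delta_h\phi_i=2d\sum_{j\ne i}\omega_j\frac{\phi_j-\phi_i}{|x_j-x_i|^2}\,w_h(|x_j-x_i|),$$ where sums run over $j\in\{1,\dots,N\}$, $j\neq i$. For $S\subset\mathbb{R}^d$, $\Lambda(S)=\{i\in\{1,\dots,N\} : x_i\in\mathcal{X}_N\cap S\}$. $V_h=\{v:\mathcal{X}_N\to\mathbb{R} : v(x_i)=0 \text{ for } i\in\Lambda(\Gamma_H)\}$. $h$-connectivity: $\mathcal{X}_N$ satisfies $h$-connectivity if for all $i\in\Lambda(\Omega)$ there exist an integer $K\ (\le N)$ and a sequence $\{i_k\}_{k=1}^K\subset\{1,\dots,N\}$ such that $i_1=i$, $|x_{i_k}-x_{i_{k+1}}|<h$ for $1\le k<K$, $i_k\in\Lambda(\Omega)$ for $1\le k<K$, and $i_K\in\Lambda(\Gamma_H)$. *)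

(* Defs.v *)
From HB Require Import structures.
From mathcomp Require Import all_boot all_order all_algebra.
From mathcomp Require Import all_classical all_reals all_analysis.

Set Implicit Arguments.
Unset Strict Implicit.
Unset Printing Implicit Defensive.

Import Order.TTheory GRing.Theory Num.Theory.
Import numFieldNormedType.Exports.

Local Open Scope classical_set_scope.
Local Open Scope ring_scope.

Section euclidean.
Context {R : realType} {d : nat}.
Implicit Types u v : 'rV[R]_d.

Definition dotp u v : R := \sum_i u 0 i * v 0 i.

(* The library norm `|u| on 'rV[R]_d is the sup norm.  It is only used here
   through the topology and the boundedness that it shares with [enorm]. *)
Definition enorm u : R := Num.sqrt (dotp u u).

End euclidean.

(* The d-dimensional Lebesgue measure: the library's Caratheodory measure of
   the outer measure given by countable covers with half-open boxes
   prod_i ]a_i, b_i]. *)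
Section lebesgue.
Context {R : realType} {d : nat}.
Local Open Scope ereal_scope.
Implicit Types c : 'rV[R]_d * 'rV[R]_d.

Definition box c : set 'rV[R]_d :=
  [set x | forall i, (c.1 0%R i < x 0%R i <= c.2 0%R i)%R].

Definition box_volume c : \bar R := (\prod_i (c.2 0 i - c.1 0 i))%:E.

Definition box_cover (A : set 'rV[R]_d) : set (set ('rV[R]_d * 'rV[R]_d)) :=
  [set C : set ('rV[R]_d * 'rV[R]_d) | [/\ countable C,
               (forall c, C c -> forall i, (c.1 0%R i <= c.2 0%R i)%R) &
               A `<=` \bigcup_(c in C) box c]].

Definition lebesgue_outer (A : set 'rV[R]_d) : \bar R :=
  ereal_inf [set \esum_(c in C) box_volume c | C in box_cover A].

Lemma box_cover_ge0 A (C : set ('rV[R]_d * 'rV[R]_d)) c : box_cover A C -> C c -> 0 <= box_volume c.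
Proof.
move=> [_ CP _] /CP /= cP; rewrite lee_fin.
by apply: prodr_ge0 => i _; rewrite subr_ge0.
Qed.

Lemma lebesgue_outer_ge0 A : 0 <= lebesgue_outer A.
Proof.
apply: le_ereal_inf_tmp => _ [C CA <-].
by apply: esum_ge0 => c Cc; exact: box_cover_ge0 CA Cc.
Qed.

Lemma lebesgue_outer0 : lebesgue_outer set0 = 0.
Proof.
apply/eqP; rewrite eq_le lebesgue_outer_ge0 andbT.
apply: ereal_inf_lbound; exists set0; last by rewrite esum_set0.
by split => // x.
Qed.

Lemma le_lebesgue_outer : {homo lebesgue_outer : A B / A `<=` B >-> A <= B}.
Proof.
move=> A B AB; apply: ereal_inf_le_tmp => x [C [cC CP BC] <-].
by exists C => //; split => //; exact: subset_trans AB BC.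
Qed.

Lemma lebesgue_outer_sigma_subadditive : sigma_subadditive lebesgue_outer.
Proof.
move=> A; have [[i ioo]|] := pselect (exists i, lebesgue_outer (A i) = +oo).
  rewrite (eseries_pinfty _ _ ioo) ?leey// => n _.
  by rewrite -ltNye (lt_le_trans _ (lebesgue_outer_ge0 _)).
rewrite -forallNE => Aoo.
apply/lee_addgt0Pr => e e0.
rewrite (le_trans _ (epsilon_trick _ _ (ltW e0)))//; last first.
  by move=> n; exact: lebesgue_outer_ge0.
pose P n (C : set ('rV[R]_d * 'rV[R]_d)) := box_cover (A n) C /\
  \esum_(c in C) box_volume c <= lebesgue_outer (A n) + (e / (2 ^ n.+1)%:R)%:E.
have [G PG] : {G : nat -> set ('rV[R]_d * 'rV[R]_d) & forall n, P n (G n)}.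
  apply: (@choice _ _ P) => n.
  have en : (0 < e / (2 ^ n.+1)%:R)%R by rewrite divr_gt0// ltr0n expn_gt0.
  have fin : lebesgue_outer (A n) \is a fin_num.
    by rewrite ge0_fin_numE ?lebesgue_outer_ge0// ltey; apply/eqP/Aoo.
  have [x [C CA <-] Cx] := lb_ereal_inf_adherent en fin.
  by exists C; split => //; exact: ltW.
have DG n : seqDU G n `<=` G n by move=> c [].
apply: (@le_trans _ _ (\esum_(c in \bigcup_n G n) box_volume c)).
  apply: ereal_inf_lbound; exists (\bigcup_n G n) => //; split.
  - by apply: bigcup_countable => // n _; case: (PG n) => -[].
  - by move=> c [n _ Gc]; case: (PG n) => -[_ + _] _; exact.
  - move=> x [n _ Anx]; case: (PG n) => -[_ _ /(_ _ Anx) [c Gc bx]] _.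
    by exists c => //; exists n.
rewrite seqDU_bigcup_eq esum_bigcup; last 2 first.
- exact: sub_trivIset (@trivIset_seqDU _ G).
- by move=> c [n _ [Gc _]]; exact: box_cover_ge0 (PG n).1 Gc.
rewrite nneseries_esumT; last first.
  by move=> n; rewrite adde_ge0 ?lebesgue_outer_ge0// lee_fin divr_ge0// ltW.
apply: le_esum => n _; apply: le_trans (PG n).2.
rewrite [leRHS](esumID (seqDU G n)) => [|c]; last exact: box_cover_ge0 (PG n).1.
rewrite setIidr// leeDl// esum_ge0// => c [Gc _].
exact: box_cover_ge0 (PG n).1 Gc.
Qed.

HB.instance Definition _ := isOuterMeasure.Build R 'rV[R]_d lebesgue_outer
  lebesgue_outer0 lebesgue_outer_ge0 le_lebesgue_outer
  lebesgue_outer_sigma_subadditive.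

Let outer : {outer_measure set 'rV[R]_d -> \bar R} := lebesgue_outer.

Definition lebesgue_rV : {measure set (caratheodory_type outer) -> \bar R} :=
  (outer : set (caratheodory_type outer) -> \bar R).

End lebesgue.

Section domains.
Context {R : realType} {d : nat}.
Implicit Types (Omega : set 'rV[R]_d) (v : 'rV[R]_d -> R).

Definition boundary Omega := closure Omega `\` Omega°.

Definition bounded_domain Omega :=
  [/\ Omega !=set0, open Omega, connected Omega & bounded_set Omega].

(* v is in C^k(closure Omega), for Omega open: v is continuous on closure Omega
   and the partial derivatives of v in Omega extend to functions g in
   C^(k-1)(closure Omega).  The values of v off closure Omega are irrelevant. *)
Fixpoint Ck_closure (k : nat) Omega v : Prop :=
  {within closure Omega, continuous v} /\
  if k is k'.+1 then
    forall i : 'I_d, exists2 g : 'rV[R]_d -> R, Ck_closure k' Omega g &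
      forall y, Omega y -> is_derive y (delta_mx 0 i : 'rV[R]_d) v (g y)
  else True.

Definition V_space Omega : set ('rV[R]_d -> R) :=
  [set v | {within closure Omega, continuous v} /\
           forall y, boundary Omega y -> v y = 0].

Definition Omega_H Omega (H : R) : set 'rV[R]_d :=
  [set x | exists2 y, Omega y & enorm (x - y) < H].

Definition Gamma_H Omega (H : R) := Omega_H Omega H `\` Omega.

End domains.

(* Near each boundary point Omega is, up to the choice of a coordinate axis k
   and of its orientation (the sign s), the strict epigraph of a C^oo function
   of the other coordinates. *)
Definition smooth_boundary (R : realType) (d : nat) (Omega : set 'rV[R]_d) :=
  forall p, boundary Omega p ->
  exists (r : R) (k : 'I_d) (s : bool) (g : 'rV[R]_d.-1 -> R),
  [/\ 0 < r,
      forall m, Ck_closure m setT g &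
      forall y, enorm (y - p) < r ->
        (Omega y <-> 0 < (-1) ^+ s * (y 0 k - g (col' k y)))].

Section weights.
Context {R : realType}.

(* Only the values of w on [0, +oo[ are constrained or used. *)
Definition reference_weight (d : nat) (w : R -> R) :=
  [/\ forall r, 0 < r < 1 -> 0 < w r,
      forall r, 1 <= r -> w r = 0,
      (@lebesgue_rV R d).-integrable setT (fun x => (w (enorm x))%:E) &
      (\int[@lebesgue_rV R d]_x (w (enorm x))%:E = 1)%E].

Definition scaled_weight (d : nat) (w : R -> R) (h r : R) : R :=
  h ^- d * w (r / h).

End weights.

(* A function on the particles is indexed by the particle numbers, phi_i being
   its value at x_i; this is faithful since x is injective. *)
Section particles.
Context {R : realType} {d N : nat}.
Implicit Types (S Omega : set 'rV[R]_d) (H h : R) (w : R -> R).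
Implicit Types (x : 'I_N -> 'rV[R]_d) (omega : 'I_N -> R).

Definition particle_distribution Omega H x :=
  injective x /\ forall i, Omega_H Omega H (x i).

Definition particle_volume_set Omega H omega :=
  (forall i, 0 < omega i) /\
  (\sum_i omega i)%:E = lebesgue_rV (Omega_H Omega H).

Definition particle_distances x : set R :=
  [set r | exists i j, i != j /\ r = enorm (x i - x j)].

(* The minimum of the distances is required to exist, which excludes N <= 1. *)
Definition influence_radius H x h :=
  0 < h /\
  exists m, [/\ particle_distances x m,
                lbound (particle_distances x) m & m < h < H].

Definition Lambda x S : set 'I_N := x @^-1` S.

Definition div_plus w x omega h (psi : {ffun 'I_N -> 'rV[R]_d}) (i : 'I_N) : R :=
  d%:R * \sum_(j | j != i)
    omega j * dotp ((enorm (x j - x i))^-1 *: (psi j + psi i))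
                   ((enorm (x j - x i))^-1 *: (x j - x i))
            * scaled_weight d w h (enorm (x j - x i)).

Definition laplacian w x omega h (phi : {ffun 'I_N -> R}) (i : 'I_N) : R :=
  (2 * d)%:R * \sum_(j | j != i)
    omega j * ((phi j - phi i) / enorm (x j - x i) ^+ 2)
            * scaled_weight d w h (enorm (x j - x i)).

Definition V_h Omega H x : set {ffun 'I_N -> R} :=
  [set v : {ffun 'I_N -> R} | forall i, Lambda x (Gamma_H Omega H) i -> v i = 0].

(* The terms s 1, ..., s K are the connecting sequence; the other values of s
   are irrelevant. *)
Definition h_connectivity Omega H x h :=
  forall i, Lambda x Omega i ->
  exists (K : nat) (s : nat -> 'I_N),
  [/\ (1 <= K <= N)%N,
      s 1%N = i,
      forall k, (1 <= k < K)%N ->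
        enorm (x (s k) - x (s k.+1)) < h /\ Lambda x Omega (s k) &
      Lambda x (Gamma_H Omega H) (s K)].

(* As every x i lies in Omega_H, the second case is i in Lambda(Gamma_H). *)
Definition f_hat Omega x (f : 'rV[R]_d -> 'rV[R]_d) : {ffun 'I_N -> 'rV[R]_d} :=
  [ffun i => if x i \in Omega then f (x i) else 0].

End particles.

(* Main.v *)
Require Import Defs.
From mathcomp Require Import all_boot all_order all_algebra.
From mathcomp Require Import all_classical all_reals all_analysis.
Import Order.TTheory GRing.Theory Num.Theory.
Import numFieldNormedType.Exports.
Local Open Scope classical_set_scope.
Local Open Scope ring_scope.

(** The discrete Poisson equation is a square linear system whose matrix is a
weighted graph Laplacian with nonnegative weights on the interior particles and
the identity on the others. A solution of the homogeneous system attains its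
maximum; there the vanishing weighted sum of nonpositive differences forces
the same value at every neighbour, hence, along a connecting sequence, at a
particle of Gamma_H, where the solution is 0. Applied to u and - u this gives
injectivity, hence bijectivity. *)

Lemma graph_maximum_principle (R : realDomainType) (T : finType)
    (A : {pred T}) (a : T -> T -> R) (u : T -> R) :
  (forall i j, 0 <= a i j) ->
  (forall i, exists2 j, j \notin A &
     connect [rel i j | (i \in A) && (0 < a i j)] i j) ->
  (forall i, i \in A -> \sum_j a i j * (u j - u i) = 0) ->
  (forall i, i \notin A -> u i = 0) ->
  forall i, u i <= 0.
Proof.
move=> a_ge0 conn harm u0 i.
case: (@Order.TotalTheory.arg_maxP _ _ _ i xpredT u isT) => m _ u_le.
apply: le_trans (u_le i isT) _.
have [j jA /connectP[p pth jE]] := conn m.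
rewrite -(u0 j jA) jE; suff -> : u (last m p) = u m by [].
have max_m k : u k <= u m by exact: u_le.
(* Only the start of the path is generalized, to a vertex [z] with [u z = u m]: the induction
   carries along the path the invariant that the current vertex attains the maximum. *)
move: (erefl (u m)) pth; move: {1 3 4}(m).
elim: p {jE} => [//|y p IHp] z uzm /= /andP[/andP[zA azy] pth].
apply: IHp pth.
have le0 k : 0 <= - (a z k * (u k - u z)).
  by rewrite -mulrN opprB mulr_ge0// uzm subr_ge0.
have /eqP := harm z zA; rewrite -oppr_eq0 -sumrN psumr_eq0// => /allP /(_ y).
rewrite mem_index_enum => /(_ isT); rewrite /= oppr_eq0 mulf_eq0 gt_eqF//=.
by rewrite subr_eq0 => /eqP ->.
Qed.

(** No symmetry of [a] is assumed, because the weight from particle [i] to particle [j] will contain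
    [omega j] but not [omega i]. *)
Lemma graph_dirichlet_problem (R : realFieldType) (n : nat)
    (A : {pred 'I_n}) (a : 'I_n -> 'I_n -> R) (b : 'I_n -> R) :
  (forall i j, 0 <= a i j) ->
  (forall i, exists2 j, j \notin A &
     connect [rel i j | (i \in A) && (0 < a i j)] i j) ->
  exists! u : {ffun 'I_n -> R},
    (forall i, i \notin A -> u i = 0) /\
    forall i, i \in A -> \sum_j a i j * (u j - u i) = b i.
Proof.
move=> a_ge0 conn.
have uniq0 (u : 'I_n -> R) : (forall i, i \in A -> \sum_j a i j * (u j - u i) = 0) ->
    (forall i, i \notin A -> u i = 0) -> forall i, u i = 0.
  move=> harm u0 i; apply/eqP; rewrite eq_le.
  rewrite (@graph_maximum_principle _ _ _ _ _ a_ge0 conn harm u0)/= -oppr_le0.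
  apply: (@graph_maximum_principle _ _ _ _ (fun k => - u k) a_ge0 conn) => k kA.
    rewrite -[RHS]oppr0 -[in RHS](harm k kA) -sumrN; apply: eq_bigr => j _.
    by rewrite -mulrN opprD.
  by rewrite u0// oppr0.
(* The unknown is a row vector multiplied by [M] on the right, so column [i] encodes the equation at
   [i]; hence the index order [(j, i)]. *)
pose M : 'M[R]_n := \matrix_(j, i)
  if i \in A then a i j - (j == i)%:R * \sum_k a i k else (j == i)%:R.
have ME (v : 'rV[R]_n) i : (v *m M) 0 i =
    if i \in A then \sum_j a i j * (v 0 j - v 0 i) else v 0 i.
  rewrite mxE; case: ifPn => iA; under eq_bigr do rewrite mxE ?iA ?(negPf iA).
    under eq_bigr do rewrite mulrBr; under [RHS]eq_bigr do rewrite mulrBr.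
    rewrite !sumrB; congr (_ - _); first by apply: eq_bigr => j _; rewrite mulrC.
    rewrite (bigD1 i)//= eqxx mul1r [X in _ + X]big1 ?addr0 => [|j /negPf ->].
      by rewrite mulrC mulr_suml.
    by rewrite mul0r mulr0.
  rewrite (bigD1 i)//= eqxx mulr1 big1 ?addr0// => j /negPf ->.
  by rewrite mulr0.
have Mu : M \in unitmx.
  rewrite -row_free_unit; apply: inj_row_free => v vM0; apply/rowP => i.
  have vM k : (v *m M) 0 k = 0 by rewrite vM0 mxE.
  rewrite mxE; apply: (uniq0 (fun k => v 0 k)) => k kA.
    by have := vM k; rewrite ME kA.
  by have := vM k; rewrite ME (negPf kA).
pose c : 'rV[R]_n := \row_i if i \in A then b i else 0.
pose v := c *m invmx M.
have vM i : (v *m M) 0 i = if i \in A then b i else 0.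
  by rewrite mulmxKV// mxE.
have v_out i : i \notin A -> v 0 i = 0.
  by move=> iA; have := vM i; rewrite ME (negPf iA).
have v_in i : i \in A -> \sum_j a i j * (v 0 j - v 0 i) = b i.
  by move=> iA; have := vM i; rewrite ME iA.
exists [ffun i => v 0 i]; split; first split=> i iA.
- by rewrite ffunE v_out.
- by rewrite -v_in//; apply: eq_bigr => j _; rewrite !ffunE.
move=> u [u_out u_in]; apply/ffunP => i; rewrite ffunE.
apply/eqP; rewrite -subr_eq0; apply/eqP.
(* The difference of two solutions solves the homogeneous problem. *)
apply: (uniq0 (fun k => v 0 k - u k)) => k kA; last by rewrite v_out ?u_out ?subr0.
rewrite -[RHS](subrr (b k)) -{1}(v_in k kA) -(u_in k kA) -sumrB.
by apply: eq_bigr => j _; rewrite -mulrBr opprD addrACA -opprD [X in _ - X]addrC.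
Qed.

Lemma enorm_ge0 (R : realType) (d : nat) (u : 'rV[R]_d) : 0 <= enorm u.
Proof. exact: sqrtr_ge0. Qed.

Lemma enorm0 (R : realType) (d : nat) : enorm (0 : 'rV[R]_d) = 0.
Proof. by rewrite /enorm /dotp big1 ?sqrtr0// => i _; rewrite mxE mul0r. Qed.

Lemma enormN (R : realType) (d : nat) (u : 'rV[R]_d) : enorm (- u) = enorm u.
Proof.
by rewrite /enorm /dotp; congr Num.sqrt; apply: eq_bigr => i _; rewrite mxE mulrNN.
Qed.

Lemma enorm_eq0 (R : realType) (d : nat) (u : 'rV[R]_d) : enorm u = 0 -> u = 0.
Proof.
move=> /eqP; rewrite sqrtr_eq0 => u_le0.
have sq_ge0 i : true -> 0 <= u 0 i * u 0 i by rewrite -expr2 sqr_ge0.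
have : dotp u u == 0 by rewrite eq_le u_le0 sumr_ge0.
rewrite psumr_eq0// => /allP u0; apply/rowP => i.
by have := u0 i (mem_index_enum i); rewrite /= mulf_eq0 orbb mxE => /eqP.
Qed.

Theorem theorem6 (R : realType) (d : nat) (d_gt0 : (0 < d)%N)
  (Omega : set 'rV[R]_d) (domOmega : bounded_domain Omega)
  (smoothOmega : smooth_boundary Omega)
  (H : R) (H_gt0 : 0 < H)
  (w : R -> R) (w_ref : reference_weight d w)
  (N : nat) (x : 'I_N -> 'rV[R]_d) (omega : 'I_N -> R) (h : R)
  (x_part : particle_distribution Omega H x)
  (omega_vol : particle_volume_set Omega H omega)
  (h_rad : influence_radius H x h)
  (x_conn : h_connectivity Omega H x h)
  (f : 'rV[R]_d -> 'rV[R]_d)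
  (f_V : forall k : 'I_d, V_space Omega (fun y => f y 0 k))
  (f_C1 : forall k : 'I_d, Ck_closure 1 Omega (fun y => f y 0 k)) :
  exists! u : {ffun 'I_N -> R},
    V_h Omega H x u /\
    forall i, Lambda x Omega i ->
      - laplacian w x omega h u i = div_plus w x omega h (f_hat Omega x f) i.
Proof.
have [w_gt0 w0 _ _] := w_ref.
have [x_inj x_in] := x_part.
have [omega_gt0 _] := omega_vol.
have [h_gt0 _] := h_rad.
pose A : {pred 'I_N} := fun i => x i \in Omega.
have inA i : (i \in A) = (x i \in Omega) by [].
have A_Lambda i : i \in A <-> Lambda x Omega i.
  by rewrite inA; split=> [/set_mem|/mem_set].
(* All particles lie in [Omega_H], so those outside [Omega] are exactly those in [Gamma_H]. *)
have notA i : i \notin A <-> Lambda x (Gamma_H Omega H) i.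
  split=> [/negP iA|[_ iO]]; last by apply/negP => /A_Lambda.
  by split=> // /A_Lambda.
(* The value at j = i is 0, because division by |x i - x i| = 0 gives 0. *)
pose a i j := (2 * d)%:R * (omega j / enorm (x j - x i) ^+ 2
                 * scaled_weight d w h (enorm (x j - x i))).
have d2_gt0 : 0 < (2 * d)%:R :> R by rewrite ltr0n muln_gt0.
have hd_gt0 : 0 < h ^- d by rewrite invr_gt0 exprn_gt0.
have aii i : a i i = 0.
  by rewrite /a subrr enorm0 expr0n invr0 mulr0 mul0r mulr0.
have enorm_gt0 i j : i != j -> 0 < enorm (x j - x i).
  move=> ij; rewrite lt_def enorm_ge0 andbT; apply: contraNneq ij.
  by move=> /enorm_eq0/eqP; rewrite subr_eq0 => /eqP/x_inj ->.
have a_gt0 i j : i != j -> enorm (x j - x i) < h -> 0 < a i j.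
  move=> ij ijh; have e_gt0 := enorm_gt0 _ _ ij.
  rewrite mulr_gt0// mulr_gt0// ?divr_gt0 ?exprn_gt0// mulr_gt0//.
  by rewrite w_gt0// divr_gt0//= ltr_pdivrMr// mul1r.
(* The sign of [w 0] is unknown, so the diagonal rests on [aii]. Off the diagonal, [w] is positive
   at distances below [h] and vanishes from [h] on. *)
have a_ge0 i j : 0 <= a i j.
  have [->|ij] := eqVneq i j; first by rewrite aii.
  have [/(a_gt0 _ _ ij)/ltW//|ge_h] := ltP (enorm (x j - x i)) h.
  by rewrite /a /scaled_weight w0 ?mulr0// ler_pdivlMr// mul1r.
have lapE u i : laplacian w x omega h u i = \sum_j a i j * (u j - u i).
  rewrite [RHS](bigD1 i)//= subrr mulr0 add0r /laplacian mulr_sumr.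
  apply: eq_bigr => j _; rewrite /a -!mulrA; congr (_ * (_ * _)).
  by rewrite [LHS]mulrC -!mulrA.
have conn i : exists2 j, j \notin A &
    connect [rel i j | (i \in A) && (0 < a i j)] i j.
  have [iA|] := boolP (i \in A); last by exists i.
  have [K [s [/andP[K_gt0 _] s1 sE sK]]] := x_conn i ((A_Lambda i).1 iA).
  exists (s K); first exact/notA.
  have sc k : (0 < k <= K)%N -> connect [rel i j | (i \in A) && (0 < a i j)] i (s k).
    elim: k => [//|[|k] IHk] /= kK; first by rewrite s1.
    apply: connect_trans (IHk (ltnW kK)) _.
    have [sh skA] := sE k.+1 kK.
    (* A connecting sequence may repeat a particle. Since [a i i = 0], this is not an edge, but then
       there is nothing to traverse. *)
    have [<-//|ne] := eqVneq (s k.+1) (s k.+2).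
    apply: connect1; rewrite /= (A_Lambda _).2//= a_gt0//.
    by rewrite -enormN opprB.
  by apply: sc; rewrite K_gt0 leqnn.
(* The minus sign in front of the Laplacian is moved to the right-hand side. *)
have [u [[u_out u_in] u_uniq]] := @graph_dirichlet_problem R N A a
  (fun i => - div_plus w x omega h (f_hat Omega x f) i) a_ge0 conn.
exists u; split.
  split=> [i /notA|i /A_Lambda iA]; first exact: u_out.
  by rewrite lapE u_in// opprK.
move=> v [v_out v_in]; apply: u_uniq; split=> i iA; first exact/v_out/notA.
by rewrite -lapE -v_in ?opprK//; exact/A_Lambda.
Qed.
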